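(* Let $X$ be a finite set of variables, $\preceq$ a monomial ordering, and $Z,P,B\subseteq\mathbb{Q}[X]$ finite with $\langle Z,P\rangle$ reduced. Consider the procedure $\mathit{rcp}(Z,P,B)$: set $\langle Z',P'\rangle:=\langle Z,P\rangle$ and let $B'$ be a basis of the point lattice $\mathbb{Z}\langle B\rangle$; repeat { $\langle Z_0,P_0\rangle:=\langle Z',P'\rangle$; $P_1:=\mathit{cut}(Z_0,P_0,B')$; $\langle Z',P'\rangle:=\mathsf{saturate}(Z_0\cup -Z_0\cup P_0\cup P_1)$; $B':=$ a basis of the point lattice $\mathbb{Z}\langle\{\mathbf{red}_{Z'}(b):b\in B'\}\rangle$ } until $\mathrm{alg.cone}(Z',P')=\mathrm{alg.cone}(Z_0,P_0)$; return $\langle Z',P'\rangle$. Then the procedure terminates and $\mathrm{alg.cone}(Z',P')$ for the returned pair is the least regular cone $C$ that contains $\mathrm{alg.cone}(Z,P)$ and is closed under cutting planes with respect to $\mathrm{units}(C)+\mathbb{Z}\langle B\rangle$.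
   Context: $\mathbb{Z}\langle S\rangle$ is the set of integer combinations of $S$; a basis of a point lattice is a linearly independent generating set. A cone contains $0$ and is closed under addition and non-negative rational scaling; $\mathrm{cone}(S)$ is the set of non-negative rational combinations of $S$; $\mathrm{units}(C)=\{p:p,-p\in C\}$; $C$ is regular if $1\in C$ and $\mathrm{units}(C)$ is an ideal. $\mathrm{alg.cone}(Z,P)=\langle Z\rangle+\mathrm{cone}(P)$; $\langle Z,P\rangle$ is reduced if $Z$ is a Gröbner basis (w.r.t. $\preceq$) and each $p\in P$ equals $\mathbf{red}_Z(p)$, its normal form modulo $Z$. $C$ is closed under cutting planes w.r.t. $L$ if for $a,b\in\mathbb{Z}$, $a>0$, $p\in L$: $ap+b\in C\Rightarrow p+\lfloor b/a\rfloor\in C$; $\mathrm{cp}_L(S)$ is the least cone containing $S$ closed under cutting planes w.r.t. $L$. $\mathsf{saturate}(Q)$ returns a reduced pair whose algebraic cone is the least regular cone containing the finite set $Q$. For $B'=\{v_1,\dots,v_n\}$, $\mathit{cut}(Z_0,P_0,B')$ returns a finite set $P_1\subseteq\mathbb{Q}[X]$ with $\mathrm{cone}(P_1)=g\big(\mathrm{cp}_{\mathbb{Z}\langle Y\rangle}(g^{-1}(\mathrm{alg.cone}(Z_0,P_0)))\big)$, where $Y=\{y_1,\dots,y_n\}$ are fresh variables, $g$ is the linear map from polynomials of degree $\le1$ over $Y$ to $\mathbb{Q}[X]$ with $g(a_0+\sum a_iy_i)=a_0+\sum a_iv_i$, and the closure is taken inside the space of degree-$\le1$ polynomials over $Y$.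 *)

(* Defs.v *)
From Stdlib Require Import Relation_Operators.
From mathcomp Require Import all_boot all_order all_algebra.
From mathcomp Require Import boolp classical_sets.
From mathcomp.multinomials Require Import mpoly.

Set Implicit Arguments.
Unset Strict Implicit.
Unset Printing Implicit Defensive.

Import Order.TTheory GRing.Theory Num.Theory.
Local Open Scope classical_set_scope.
Local Open Scope ring_scope.

(* Finite subsets of Q[X] are given by enumerating sequences. *)

Definition is_least (T : Type) (Pr : set T -> Prop) (C : set T) : Prop :=
  Pr C /\ forall D : set T, Pr D -> C `<=` D.

Definition zspan (V : zmodType) (S : seq V) : set V :=
  [set v | exists c : 'I_(size S) -> int, v = \sum_(i < size S) S`_i *~ c i].

Definition lin_indep (V : lmodType rat) (S : seq V) : Prop :=
  forall c : 'I_(size S) -> rat,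
    \sum_(i < size S) c i *: S`_i = 0 -> forall i, c i = 0.

Definition lattice_basis (V : lmodType rat) (B B' : seq V) : Prop :=
  lin_indep B' /\ zspan B' = zspan B.

Definition is_cone (V : lmodType rat) (C : set V) : Prop :=
  [/\ C 0,
      forall p q, C p -> C q -> C (p + q)
    & forall (k : rat) p, 0 <= k -> C p -> C (k *: p)].

Definition cone (V : lmodType rat) (S : seq V) : set V :=
  [set v | exists c : 'I_(size S) -> rat,
     (forall i, 0 <= c i) /\ v = \sum_(i < size S) c i *: S`_i].

Definition units (V : zmodType) (C : set V) : set V :=
  [set p | C p /\ C (- p)].

Definition setadd (V : zmodType) (A B : set V) : set V :=
  [set a + b | a in A & b in B].

Section Polynomials.
Variable n : nat.
Implicit Types (p q r z : {mpoly rat[n]}) (Z P B Q : seq {mpoly rat[n]})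
  (C L S : set {mpoly rat[n]}).

Definition is_ideal (I : set {mpoly rat[n]}) : Prop :=
  [/\ I 0,
      forall p q, I p -> I q -> I (p + q)
    & forall p q, I q -> I (p * q)].

Definition ideal Z : set {mpoly rat[n]} :=
  [set p | exists c : 'I_(size Z) -> {mpoly rat[n]},
     p = \sum_(i < size Z) c i * Z`_i].

Definition regular C : Prop := [/\ is_cone C, C 1 & is_ideal (units C)].

Definition alg_cone Z P : set {mpoly rat[n]} := setadd (ideal Z) (cone P).

(* a p + b in C implies p + floor(b / a) in C, for integers a > 0 and b. *)
Definition cp_closed L C : Prop :=
  forall (a b : int) p, 0 < a -> L p ->
    C (p *~ a + b%:~R) -> C (p + (Num.floor (b%:Q / a%:Q))%:~R).

(* The least cone inside the subspace W that contains S and is closed under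
   cutting planes with respect to L. *)
Definition cp (W L S : set {mpoly rat[n]}) : set {mpoly rat[n]} :=
  [set p | forall C, C `<=` W -> is_cone C -> S `<=` C -> cp_closed L C -> C p].

Definition monomial_order (le : rel 'X_{1..n}) : Prop :=
  [/\ [/\ reflexive le, antisymmetric le, transitive le & total le],
      forall m1 m2 m, le m1 m2 -> le (m1 + m)%MM (m2 + m)%MM
    & well_founded (fun m1 m2 => le m1 m2 /\ m1 <> m2)].

Section MonomialOrder.
Variable le : rel 'X_{1..n}.

(* False when p = 0. *)
Definition is_lead p (m : 'X_{1..n}) : Prop :=
  m \in msupp p /\ forall m', m' \in msupp p -> le m' m.

(* The comparison (m' <= m)%MM is divisibility of monomials. *)
Definition groebner Z : Prop :=
  forall p m, ideal Z p -> is_lead p m ->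
    exists z m', [/\ z \in Z, is_lead z m' & (m' <= m)%MM].

Definition reduces Z p q : Prop :=
  exists z m' m, [/\ z \in Z, is_lead z m', m \in msupp p, (m' <= m)%MM
    & q = p - (p@_m / z@_m') *: ('X_[(m - m')%MM] * z)].

Definition normal_form Z p r : Prop :=
  clos_refl_trans _ (reduces Z) p r /\ forall q, ~ reduces Z r q.

(* A normal form always exists for a monomial order, so the default value p of
   xget is never used; it is unique when Z is a Groebner basis. *)
Definition red Z p : {mpoly rat[n]} := xget p [set r | normal_form Z p r].

Definition reduced Z P : Prop :=
  groebner Z /\ forall p, p \in P -> p = red Z p.

Definition saturate_spec
    (saturate : seq {mpoly rat[n]} -> seq {mpoly rat[n]} * seq {mpoly rat[n]})
    : Prop :=
  forall Q, let ZP := saturate Q in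
    reduced ZP.1 ZP.2 /\
    is_least (fun C => regular C /\ [set q | q \in Q] `<=` C)
             (alg_cone ZP.1 ZP.2).

End MonomialOrder.
End Polynomials.

Definition affine_polys (m : nat) : set {mpoly rat[m]} :=
  [set f | (msize f <= 2)%N].

(* Only meaningful on affine_polys (size B): it sends a_0 + sum_i a_i y_i to
   a_0 + sum_i a_i v_i, where v_i is the i-th element of B. *)
Definition affine_subst n (B : seq {mpoly rat[n]}) (f : {mpoly rat[size B]}) :
    {mpoly rat[n]} :=
  (f@_0%MM)%:MP + \sum_(i < size B) f@_(U_(i)%MM) *: B`_i.

Definition cut_set n (Z P B : seq {mpoly rat[n]}) : set {mpoly rat[n]} :=
  let W := @affine_polys (size B) in
  let Y := [seq 'X_i | i <- enum 'I_(size B)] in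
  let g := @affine_subst n B in
  g @` cp W (zspan Y) (W `&` g @^-1` alg_cone Z P).

Definition cut_spec n (le : rel 'X_{1..n})
    (cut : seq {mpoly rat[n]} -> seq {mpoly rat[n]} -> seq {mpoly rat[n]} ->
           seq {mpoly rat[n]}) : Prop :=
  forall Z P B, reduced le Z P -> lin_indep B ->
    cone (cut Z P B) = cut_set Z P B.

Section Procedure.
Variables (n : nat) (le : rel 'X_{1..n}).
Variable saturate :
  seq {mpoly rat[n]} -> seq {mpoly rat[n]} * seq {mpoly rat[n]}.
Variable cut :
  seq {mpoly rat[n]} -> seq {mpoly rat[n]} -> seq {mpoly rat[n]} ->
  seq {mpoly rat[n]}.

(* The values of the variables Z', P', B'. *)
Record rcp_state := RcpState {
  st_Z : seq {mpoly rat[n]};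
  st_P : seq {mpoly rat[n]};
  st_B : seq {mpoly rat[n]} }.

Definition st_cone (s : rcp_state) := alg_cone (st_Z s) (st_P s).

(* One execution of the loop body, nondeterministic in the choice of basis. *)
Definition rcp_body (s s' : rcp_state) : Prop :=
  let: RcpState Z0 P0 B0 := s in
  let: RcpState Z' P' B' := s' in
  let P1 := cut Z0 P0 B0 in
  (Z', P') = saturate (Z0 ++ [seq - z | z <- Z0] ++ P0 ++ P1) /\
  lattice_basis [seq red le Z' b | b <- B0] B'.

(* Every execution of the loop from s is finite, and none gets stuck. *)
Inductive rcp_terminates (s : rcp_state) : Prop :=
| RcpTerminates of
    (exists s', rcp_body s s') &
    (forall s', rcp_body s s' -> st_cone s' <> st_cone s -> rcp_terminates s').

(* Some execution of the loop from s returns the given pair. *)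
Inductive rcp_returns (s : rcp_state) (Z P : seq {mpoly rat[n]}) : Prop :=
| RcpExit s' of rcp_body s s' & st_cone s' = st_cone s &
    st_Z s' = Z & st_P s' = P
| RcpLoop s' of rcp_body s s' & st_cone s' <> st_cone s &
    rcp_returns s' Z P.

End Procedure.

(* Main.v *)
Require Import Defs.
From HB Require Import structures.
From mathcomp Require Import all_boot all_order all_algebra.
From mathcomp Require Import boolp classical_sets.
From mathcomp.multinomials Require Import mpoly.

(* Write C_k for the cones of the successive states and L_k for the lattices
   spanned by their bases. Reduction modulo Z' changes a polynomial by an
   element of the ideal of Z', which consists of units, so units(D) + L_k does
   not depend on k for any cone D containing all C_k up to that point; hence
   the regular cones to be minimized over are the same for all states, and the
   exit condition says that the current cone is one of them.

   For termination, C_{k+1} is the least regular cone containing C_k and the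
   cut K of C_k. If the units of C_{k+1} and C_k coincide, then C_k + K has the
   same units, so it is regular and equals C_{k+1}; since K contains the part of
   C_k in Q + Q L_k, the cone C_{k+1} meets Q + Q L_k in K, which is closed under
   cutting planes, and the next iteration exits. Otherwise the ideal of units
   has grown, which happens finitely often because Q[X] is Noetherian. *)

Set Implicit Arguments.
Unset Strict Implicit.
Unset Printing Implicit Defensive.

Import Order.TTheory GRing.Theory Num.Theory.
Local Open Scope classical_set_scope.
Local Open Scope ring_scope.

(** * Ascending chains of ideals *)

(** A point that is not accessible has a predecessor that is not accessible either; dependent choice
    iterates this. *)
Lemma not_wf_descending (T : Type) (R : T -> T -> Prop) :
  ~ well_founded R -> exists f : nat -> T, forall k, R (f k.+1) (f k).
Proof.
move=> /existsNP[x0 nAcc0].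
have step (x : {x | ~ Acc R x}) :
    exists y : {x | ~ Acc R x}, R (projT1 y) (projT1 x).
  case: x => x nAcc /=; apply: contrapT => noy; apply: nAcc.
  constructor=> y Ryx; apply: contrapT => nAccy.
  by apply: noy; exists (exist _ y nAccy).
have [next nextP] := choice step.
exists (fun k => projT1 (iter k next (exist _ x0 nAcc0))) => k /=.
exact: nextP.
Qed.

(** Each new index is the position of a minimum of [f] on the tail beyond the previous one. *)
Lemma nat_seq_nondecreasing_subseq (f : nat -> nat) :
  exists phi : nat -> nat, {homo phi : i j / (i < j)%N} /\
    {homo f \o phi : i j / (i <= j)%N}.
Proof.
have tail_min i : exists j, (i <= j)%N /\ forall k, (i <= k)%N -> (f j <= f k)%N.
  have exv : exists v, `[< exists2 j, (i <= j)%N & f j = v >].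
    by exists (f i); apply/asboolP; exists i.
  case: (ex_minnP exv) => v /asboolP[j ij <-] vmin.
  by exists j; split=> // k ik; apply: vmin; apply/asboolP; exists k.
have [M MP] := choice tail_min.
(* [psi k] is where the k-th tail starts; the successor makes each chosen minimum strictly later
   than the one before. *)
pose psi k := iter k (fun i => (M i).+1) 0%N.
have psiM k : (psi k <= M (psi k))%N by case: (MP (psi k)).
exists (fun k => M (psi k)); split.
  apply: homo_ltn; first exact: ltn_trans.
  by move=> k; apply: (leq_trans _ (psiM k.+1)).
apply: homo_leq => //; first exact: leq_trans.
move=> k /=; apply: (MP (psi k)).2.
exact: leq_trans (leq_trans (psiM k) (leqnSn _)) (psiM k.+1).
Qed.

(** Passing to a subsequence once per coordinate makes all coordinates nondecreasing, so any two
    terms that remain will do. *)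
Lemma dickson n (f : nat -> 'X_{1..n}) :
  exists i j, (i < j)%N /\ (f i <= f j)%MM.
Proof.
have sorted_coords k : exists phi : nat -> nat,
    {homo phi : i j / (i < j)%N} /\
    forall a : 'I_n, (a < k)%N -> {homo (fun i => f (phi i) a) : i j / (i <= j)%N}.
  elim: k => [|k [phi [phi_lt phiP]]]; first by exists id; split.
  have [kn|nk] := ltnP k n; last first.
    exists phi; split=> // a ak; apply: phiP.
    exact: leq_trans (ltn_ord a) nk.
  have [psi [psi_lt psiP]] :=
    nat_seq_nondecreasing_subseq (fun i => f (phi i) (Ordinal kn)).
  exists (phi \o psi); split=> [i j /psi_lt/phi_lt //|a].
  rewrite ltnS leq_eqVlt => /orP[/eqP ak|ak] i j ij /=.
    by have -> : a = Ordinal kn by [apply: val_inj]; apply: psiP.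
  by apply: phiP => //; rewrite (ltnW_homo psi_lt).
have [phi [phi_lt phiP]] := sorted_coords n.
exists (phi 0%N), (phi 1%N); split; first exact: phi_lt.
by apply/mnm_lepP => a; apply: phiP.
Qed.

Lemma ideal_scale n (I : set {mpoly rat[n]}) c p :
  is_ideal I -> I p -> I (c *: p).
Proof. by case=> _ _ IM Ip; rewrite -mul_mpolyC; apply: IM. Qed.

Lemma ideal_sub n (I : set {mpoly rat[n]}) p q :
  is_ideal I -> I p -> I q -> I (p - q).
Proof.
move=> idI Ip Iq; case: (idI) => _ ID _; apply: ID => //.
by rewrite -scaleN1r; apply: ideal_scale.
Qed.

(** The subtracted multiple of [q] has the leading term of [p]. Leading monomials are taken in the
    fixed order of the monomial type, independent of the order [le] of the procedure. *)
Lemma mlead_cancel n (p q : {mpoly rat[n]}) : p != 0 -> q != 0 ->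
  (mlead q <= mlead p)%MM ->
  let r := p - (mleadc p / mleadc q) *: ('X_[(mlead p - mlead q)%MM] * q) in
  r = 0 \/ (mlead r < mlead p)%O.
Proof.
move=> p0 q0 qp r; have [->|r0] := eqVneq r 0; [by left|right].
have le_r : (mlead r <= mlead p)%O.
  apply: le_trans (mleadB_le _ _) _; rewrite leUx lexx /=.
  apply: le_trans (mleadZ_le _ _) _; apply: le_trans (mleadM_le _ _) _.
  by rewrite mleadXm submK.
rewrite lt_neqAle le_r andbT; apply/eqP => rp.
move: (r0); rewrite -mleadc_eq0 rp /r mcoeffB mcoeffZ.
rewrite -{3}(submK qp) mulrC [_ * q]mulrC mcoeffMX.
by rewrite mulrC divfK ?subrr ?eqxx // mleadc_eq0.
Qed.

(* Choose [p k] in [I k.+1] but not in [I k] with minimal leading monomial.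
   By Dickson's lemma some [mlead (p i)] divides a later [mlead (p j)], and
   cancelling the leading term of [p j] contradicts its minimality. *)
Lemma ideal_ascending_chain n (I : nat -> set {mpoly rat[n]}) :
  (forall k, is_ideal (I k)) -> (forall k, I k `<=` I k.+1) ->
  exists k, I k.+1 = I k.
Proof.
move=> idI incI; apply: contrapT => nstab.
have I_le : {homo I : i j / (i <= j)%N >-> i `<=` j}.
  apply: homo_leq incI; first exact: subset_refl.
  by move=> B A C; apply: subset_trans.
pose fresh k p := I k.+1 p /\ ~ I k p.
have ex_min k : exists p, fresh k p /\
    forall q, fresh k q -> ~ (mlead q < mlead p)%O.
  have [p0 p0P] : exists p, fresh k p.
    apply: contrapT => nofresh; apply: nstab; exists k; apply/seteqP.
    split=> [p Ip|]; last exact: incI.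
    by apply: contrapT => nIp; apply: nofresh; exists p.
  move: p0P; move: {2}(mlead p0) (erefl (mlead p0)) => m.
  elim/(well_founded_ind (@ltom_wf n)): m p0 => m IH p0 p0m p0P.
  have [[q [qP qm]]|noq] := pselect (exists q, fresh k q /\ (mlead q < m)%O).
    exact: IH qm q erefl qP.
  exists p0; split=> // q qP; rewrite p0m => qm.
  by apply: noq; exists q.
have [p pP] := choice ex_min.
have p_neq0 k : p k != 0.
  apply/eqP => pk0; case: (pP k) => -[_ nI] _; apply: nI.
  by rewrite pk0; case: (idI k).
have [i [j [ij div_ij]]] := dickson (fun k => mlead (p k)).
have Ij_pi : I j (p i) by apply: (I_le i.+1) => //; case: (pP i) => -[].
case: (pP j) => -[Ij1 nIj] minj.
set s := (mleadc (p j) / mleadc (p i)) *: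
  ('X_[(mlead (p j) - mlead (p i))%MM] * p i).
have Ij_s : I j s.
  by apply: ideal_scale => //; case: (idI j) => _ _; apply.
have fresh_r : fresh j (p j - s).
  split; first by apply: ideal_sub => //; apply: incI.
  by move=> Ir; apply: nIj; rewrite -(subrK s (p j)); case: (idI j) => _ + _; apply.
have [r0|] := mlead_cancel (p_neq0 j) (p_neq0 i) div_ij; last exact: minj.
by case: fresh_r => _; rewrite /s r0; apply; case: (idI j).
Qed.

(** The Noetherian property as an induction principle in which larger ideals count as smaller; the
    termination proof uses it in this form. *)
Lemma ideal_supset_wf n : well_founded (fun I J : set {mpoly rat[n]} =>
  [/\ is_ideal I, is_ideal J, J `<=` I & I <> J]).
Proof.
apply: contrapT => /not_wf_descending[f fP].
have [k||k fk] := @ideal_ascending_chain _ f.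
- by case: (fP k).
- by move=> k; case: (fP k).
- by case: (fP k).
Qed.

(** * Bases of point lattices *)

Section Spans.
Variable V : lmodType rat.
Implicit Types (S B : seq V) (u v x : V).

(* Coefficient families indexed by [nat] instead of ['I_(size S)] avoid
   casts when the sequence changes. *)
Lemma ord_family_ext (T : Type) (m : nat) (c0 : T) (c : 'I_m -> T) :
  exists c' : nat -> T, forall i : 'I_m, c' i = c i.
Proof. by exists (fun k => oapp c c0 (insub k)) => i; rewrite valK. Qed.

Lemma zspanP S v :
  zspan S v <-> exists c : nat -> int, v = \sum_(i < size S) S`_i *~ c i.
Proof.
split=> [[c ->]|[c ->]]; last by exists c.
have [c' c'E] := ord_family_ext 0 c; exists c'.
by apply: eq_bigr => i _; rewrite c'E.
Qed.

Lemma zspan_nil v : zspan [::] v <-> v = 0.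
Proof.
split=> [[c ->]|->]; first by rewrite big_ord0.
by exists (fun=> 0); rewrite big_ord0.
Qed.

Lemma zspan_cons x S v : zspan (x :: S) v <-> exists k, zspan S (v - x *~ k).
Proof.
split=> [/zspanP[c ->]|[k /zspanP[c vE]]].
  exists (c 0%N); apply/zspanP; exists (c \o succn).
  by rewrite big_ord_recl /= addrC addKr.
apply/zspanP; exists (fun i => if i is j.+1 then c j else k).
by rewrite big_ord_recl /= -vE addrC subrK.
Qed.

Lemma zspan0 S : zspan S 0.
Proof. by apply/zspanP; exists (fun=> 0); rewrite big1. Qed.

Lemma zspanB S u v : zspan S u -> zspan S v -> zspan S (u - v).
Proof.
move=> /zspanP[c ->] /zspanP[d ->]; apply/zspanP; exists (fun i => c i - d i).
by rewrite -sumrB; apply: eq_bigr => i _; rewrite mulrzBr.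
Qed.

Lemma zspanN S v : zspan S v -> zspan S (- v).
Proof. by rewrite -sub0r; apply: zspanB; apply: zspan0. Qed.

Lemma zspanD S u v : zspan S u -> zspan S v -> zspan S (u + v).
Proof. by move=> Su Sv; rewrite -(opprK v); apply/zspanB/zspanN. Qed.

Lemma zspanMz S v k : zspan S v -> zspan S (v *~ k).
Proof.
move=> /zspanP[c ->]; apply/zspanP; exists (fun i => c i * k).
by rewrite mulrz_suml; apply: eq_bigr => i _; rewrite mulrzA.
Qed.

Lemma zspan_mem S v : v \in S -> zspan S v.
Proof.
elim: S => // x S IH; rewrite inE => /predU1P[->|vS]; apply/zspan_cons.
  by exists 1; rewrite subrr; apply: zspan0.
by exists 0; rewrite mulr0z subr0; apply: IH.
Qed.

Lemma subgroupN (G : set V) u : G 0 ->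
  (forall v w, G v -> G w -> G (v - w)) -> G u -> G (- u).
Proof. by move=> G0 GB Gu; rewrite -sub0r; apply: GB. Qed.

Lemma subgroupD (G : set V) u v : G 0 ->
  (forall v w, G v -> G w -> G (v - w)) -> G u -> G v -> G (u + v).
Proof.
by move=> G0 GB Gu Gv; rewrite -(opprK v); apply: (GB) (Gu) (subgroupN G0 GB Gv).
Qed.

Lemma subgroupMz (G : set V) u k : G 0 ->
  (forall v w, G v -> G w -> G (v - w)) -> G u -> G (u *~ k).
Proof.
move=> G0 GB Gu; have GMn m : G (u *+ m).
  elim: m => [|m IH]; first by rewrite mulr0n.
  by rewrite mulrS; apply: (subgroupD G0 GB).
case: k => m; first exact: GMn.
by rewrite NegzE mulrNz; apply: (subgroupN G0 GB (GMn m.+1)).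
Qed.

Lemma zspan_sub S (G : set V) : G 0 ->
  (forall u v, G u -> G v -> G (u - v)) -> (forall v, v \in S -> G v) ->
  zspan S `<=` G.
Proof.
move=> G0 GB; elim: S => [|x S IH] GS v; first by move/zspan_nil->.
move=> /zspan_cons[k /IH Gv]; rewrite -(subrK (x *~ k) v).
apply: (subgroupD G0 GB) => //; first by apply: Gv => w wS; apply: GS; rewrite inE wS orbT.
by apply: (subgroupMz _ G0 GB); apply: GS; rewrite mem_head.
Qed.

Definition qspan S : set V :=
  [set v | exists c : nat -> rat, v = \sum_(i < size S) c i *: S`_i].

Lemma qspan_nil v : qspan [::] v <-> v = 0.
Proof.
split=> [[c ->]|->]; first by rewrite big_ord0.
by exists (fun=> 0); rewrite big_ord0.
Qed.

Lemma qspan_cons x S v : qspan (x :: S) v <-> exists k, qspan S (v - k *: x).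
Proof.
split=> [[c ->]|[k [c vE]]].
  exists (c 0%N), (c \o succn).
  by rewrite big_ord_recl /= addrC addKr.
exists (fun i => if i is j.+1 then c j else k).
by rewrite big_ord_recl /= -vE addrC subrK.
Qed.

Lemma qspan_linear S a u v : qspan S u -> qspan S v -> qspan S (a *: u + v).
Proof.
move=> [c ->] [d ->]; exists (fun i => a * c i + d i).
rewrite scaler_sumr -big_split; apply: eq_bigr => i _ /=.
by rewrite scalerDl scalerA.
Qed.

Lemma qspan0 S : qspan S 0.
Proof. by exists (fun=> 0); rewrite big1 // => i _; rewrite scale0r. Qed.

Lemma qspanZ S a v : qspan S v -> qspan S (a *: v).
Proof. by move=> Sv; rewrite -[_ *: _]addr0; apply/qspan_linear/qspan0. Qed.

Lemma qspanB S u v : qspan S u -> qspan S v -> qspan S (u - v).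
Proof. by move=> Su Sv; rewrite addrC -scaleN1r; apply: qspan_linear. Qed.

Lemma zspan_qspan S : zspan S `<=` qspan S.
Proof.
move=> v /zspanP[c ->]; exists (fun i => (c i)%:~R).
by apply: eq_bigr => i _; rewrite scaler_int.
Qed.

Lemma qspan_sub S B : (forall v, v \in B -> qspan S v) -> qspan B `<=` qspan S.
Proof.
elim: B => [|x B IH] BS v; first by move/qspan_nil->; apply: qspan0.
move=> /qspan_cons[k /IH Sv]; rewrite -(subrK (k *: x) v) addrC.
apply: qspan_linear; first by apply: BS; rewrite mem_head.
by apply: Sv => w wB; apply: BS; rewrite inE wB orbT.
Qed.

Lemma lin_indepP S : lin_indep S <-> forall c : nat -> rat,
  \sum_(i < size S) c i *: S`_i = 0 -> forall i, (i < size S)%N -> c i = 0.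
Proof.
split=> [indS c c0 i iS|indS c c0 i].
  exact: (indS (fun i => c i) c0 (Ordinal iS)).
have [c' c'E] := ord_family_ext 0 c; rewrite -c'E; apply: indS => //.
by rewrite -[RHS]c0; apply: eq_bigr => j _; rewrite c'E.
Qed.

Lemma lin_indep_cons x S :
  lin_indep (x :: S) <-> lin_indep S /\ ~ qspan S x.
Proof.
split=> [/lin_indepP indxS|[/lin_indepP indS nSx]].
  split=> [|[c xE]].
    apply/lin_indepP => c c0 i iS.
    apply: (indxS (fun i => if i is j.+1 then c j else 0) _ i.+1) => //.
    by rewrite big_ord_recl /= scale0r add0r.
  have := indxS (fun i => if i is j.+1 then c j else -1).
  rewrite big_ord_recl /= -xE scaleN1r addNr => /(_ erefl 0%N isT)/eqP.
  by rewrite oppr_eq0 oner_eq0.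
apply/lin_indepP => c; rewrite big_ord_recl /= => c0.
have c00 : c 0%N = 0.
  apply/eqP/negPn/negP => cN0; apply: nSx.
  exists (fun i => - (c 0%N)^-1 * c i.+1); apply: (scalerI cN0).
  rewrite (eqP (_ : c 0%N *: x == - \sum_(i < size S) c i.+1 *: S`_i)); last first.
    by rewrite -addr_eq0 c0.
  rewrite scaler_sumr -sumrN; apply: eq_bigr => i _.
  by rewrite scalerA mulrA mulrN divff // mulN1r scaleNr.
case=> // i iS; apply: (indS (c \o succn)) => //=.
by rewrite -[RHS]c0 c00 scale0r add0r.
Qed.

Lemma lin_indep_nil : lin_indep ([::] : seq V).
Proof. by move=> c _ []. Qed.

Lemma lin_indep_scale a S : a != 0 ->
  lin_indep S -> lin_indep [seq a *: v | v <- S].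
Proof.
move=> a0 /lin_indepP indS; apply/lin_indepP => c; rewrite size_map => c0.
apply: indS; apply: (scalerI a0); rewrite scaler0 -[RHS]c0 scaler_sumr.
by apply: eq_bigr => i _; rewrite (nth_map 0) // !scalerA mulrC.
Qed.

Lemma zspan_scale a S v :
  zspan S v -> zspan [seq a *: w | w <- S] (a *: v).
Proof.
move=> /zspanP[c ->]; apply/zspanP; exists c; rewrite size_map scaler_sumr.
by apply: eq_bigr => i _; rewrite (nth_map 0) // scalerMzr.
Qed.

(** Clears the denominators of the coefficients one after the other. *)
Lemma qspan_denominator S v : qspan S v ->
  exists2 d : int, d != 0 & zspan S (v *~ d).
Proof.
elim: S v => [|x S IH] v.
  move/qspan_nil->; exists 1 => //; exact: zspan0.
move=> /qspan_cons[k /IH[d d0 dS]]; exists (d * denq k).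
  by rewrite mulf_neq0 // denq_neq0.
apply/zspan_cons; exists (d * numq k).
rewrite [in X in _ - X]mulrC (_ : x *~ (numq k * d) = (k *: x) *~ d *~ denq k).
  by rewrite !mulrzA -mulrzBl -mulrzBl; apply: zspanMz.
rewrite -!scaler_int !scalerA; congr (_ *: _).
by rewrite intrM numqE [RHS]mulrC mulrA.
Qed.

(** If a generator depends rationally on the family [B] found so far, some nonzero multiple [d] of
    it lies in the lattice of [B]; dividing [B] by [d] takes the generator in and keeps all earlier
    ones. *)
Lemma indep_superlattice S :
  exists2 B, lin_indep B & forall v, v \in S -> zspan B v.
Proof.
elim: S => [|x S [B indB SB]]; first by exists [::]; first exact: lin_indep_nil.
have [Bx|nBx] := pselect (qspan B x); last first.
  exists (x :: B); first exact/lin_indep_cons.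
  move=> v; rewrite inE => /predU1P[->|/SB Bv].
    exact/zspan_mem/mem_head.
  by apply/zspan_cons; exists 0; rewrite mulr0z subr0.
have [d d0 Bdx] := qspan_denominator Bx.
have dQ0 : d%:~R != 0 :> rat by rewrite intr_eq0.
exists [seq (d%:~R)^-1 *: w | w <- B]; first by apply: lin_indep_scale; rewrite ?invr_eq0.
have downscale v : zspan B (v *~ d) -> zspan [seq (d%:~R)^-1 *: w | w <- B] v.
  move=> /(zspan_scale (d%:~R)^-1); rewrite -scaler_int scalerA mulVf //.
  by rewrite scale1r.
move=> v; rewrite inE => /predU1P[->|/SB Bv]; apply: downscale => //.
exact: zspanMz.
Qed.

(* Split off one generator at a time: the coefficients of [x] in [G] form a
   subgroup of the integers, and an element [g] of [G] realizing its positive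
   generator [d] is added to a basis of the part of [G] without [x]. *)
Lemma subgroup_basis S (G : set V) : lin_indep S -> G 0 ->
  (forall u v, G u -> G v -> G (u - v)) -> G `<=` zspan S ->
  exists2 B, lin_indep B & zspan B = G.
Proof.
elim: S G => [|x S IH] G indS G0 GB GS.
  exists [::]; first exact: lin_indep_nil.
  apply/seteqP; split=> [v /zspan_nil-> //|v /GS/zspan_nil->]; exact: zspan0.
have [indS' nSx] := (lin_indep_cons x S).1 indS.
pose H := G `&` zspan S.
have [B indB BH] : exists2 B, lin_indep B & zspan B = H.
  apply: IH => //; first by split=> //; exact: zspan0.
    by move=> u v [Gu Su] [Gv Sv]; split; [apply: GB|apply: zspanB].
  by move=> v [].
have [[d0 [d0pos [g0 [Gg0 Sg0]]]]|nocoef] := pselect (exists d : nat, (0 < d)%N /\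
    exists g, G g /\ zspan S (g - x *~ d)); last first.
  (* Since [G] is closed under negation, a negative coefficient of [x] would give a positive one, so
     here all of them vanish. *)
  exists B => //; rewrite BH; apply/seteqP; split=> [v []//|v Gv]; split=> //.
  have /zspan_cons[k Sk] := GS _ Gv.
  case: k Sk => [[|k]|k] Sk; first by rewrite mulr0z subr0 in Sk.
    by case: nocoef; exists k.+1; split=> //; exists v.
  case: nocoef; exists k.+1; split=> //; exists (- v); split.
    exact: (subgroupN G0 GB).
  by move/zspanN: Sk; rewrite NegzE opprB mulrNz addrC.
have exd : exists d : nat, `[< (0 < d)%N /\ exists g, G g /\ zspan S (g - x *~ d) >].
  by exists d0; apply/asboolP; split=> //; exists g0.
case: (ex_minnP exd) => d /asboolP[dpos [g [Gg Sg]]] dmin.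
have dN0 : (d%:Z)%:~R != 0 :> rat by rewrite intr_eq0 -lt0n.
exists (g :: B).
  (* Otherwise [g], and with it [x], would be a rational combination of [S]. *)
  apply/lin_indep_cons; split=> // Bg; apply: nSx.
  have {}Bg : qspan S g.
    apply: qspan_sub Bg => v /zspan_mem; rewrite BH => -[_]; exact: zspan_qspan.
  rewrite -(scale1r x) -(mulVf dN0) -scalerA; apply: qspanZ.
  rewrite scaler_int -(subKr g (x *~ d)); apply: qspanB => //.
  exact: zspan_qspan.
apply/seteqP; split=> [v /zspan_cons[k]|v Gv].
  rewrite BH => -[Gv _]; rewrite -(subrK (g *~ k) v).
  by apply: (subgroupD G0 GB) => //; apply: (subgroupMz _ G0 GB).
have /zspan_cons[k Sk] := GS _ Gv.
(* Removing the quotient multiple of [g] leaves [x] with the remainder as coefficient, which is zero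
   by the minimality of [d]. *)
apply/zspan_cons; exists (k %/ d)%Z; rewrite BH.
have Gr : G (v - g *~ (k %/ d)%Z) by apply: (GB) => //; apply: (subgroupMz _ G0 GB).
split=> //.
have Sr : zspan S (v - g *~ (k %/ d)%Z - x *~ (k %% d)%Z).
  have -> : v - g *~ (k %/ d)%Z - x *~ (k %% d)%Z =
      v - x *~ k - (g - x *~ d) *~ (k %/ d)%Z.
    move: (divz_eq k d); move: (k %/ d)%Z (k %% d)%Z => q r ->.
    rewrite mulrzBl mulrzDr -mulrzA [(d%:Z * _)%R]mulrC.
    rewrite opprB opprD addrA [RHS]addrAC addrA [RHS]addrC 3!addrA.
    by rewrite [_ + v]addrC addrK [RHS]addrAC.
  by apply: zspanB => //; apply: zspanMz.
have : (k %% d)%Z < d by rewrite ltz_pmod.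
have : 0 <= (k %% d)%Z by rewrite modz_ge0 // -lt0n.
case: (k %% d)%Z Sr => // -[|r] Sr _ rd; first by rewrite mulr0z subr0 in Sr.
have /dmin : `[< (0 < r.+1)%N /\ exists g, G g /\ zspan S (g - x *~ r.+1) >].
  by apply/asboolP; split=> //; exists (v - g *~ (k %/ d)%Z).
by rewrite leqNgt -ltz_nat rd.
Qed.

(** Lets the procedure choose its bases: [zspan S] is a subgroup of the lattice of some independent
    family. *)
Lemma lattice_basis_exists S : exists B, lattice_basis S B.
Proof.
have [B indB SB] := indep_superlattice S.
have [|u v|v|B' indB' B'E] := @subgroup_basis B (zspan S) indB.
- exact: zspan0.
- exact: zspanB.
- by apply: zspan_sub SB v; [exact: zspan0|move=> ? ?; exact: zspanB].
- by exists B'.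
Qed.

End Spans.

(** * Cones and cutting planes *)

Section Cones.
Variable V : lmodType rat.
Implicit Types (C D L : set V) (u v : V).

Lemma units0 C : is_cone C -> units C 0.
Proof. by case=> C0 _ _; split; rewrite ?oppr0. Qed.

Lemma unitsB C u v : is_cone C -> units C u -> units C v -> units C (u - v).
Proof.
by case=> _ CD _ [Cu CNu] [Cv CNv]; split; rewrite ?opprB 1?addrC; apply: CD.
Qed.

Lemma unitsN C u : units C u -> units C (- u).
Proof. by case=> Cu CNu; split; rewrite ?opprK. Qed.

Lemma unitsMz C u k : is_cone C -> units C u -> units C (u *~ k).
Proof.
by move=> coneC; apply: subgroupMz; [exact: units0|move=> v w; exact: unitsB].
Qed.

Lemma units_subset C D : C `<=` D -> units C `<=` units D.
Proof. by move=> CD v [/CD Dv /CD DNv]. Qed.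

Lemma cone_is_cone (S : seq V) : is_cone (cone S).
Proof.
split=> [|p q [c [c0 ->]] [d [d0 ->]]|k p k0 [c [c0 ->]]].
- by exists (fun=> 0); split=> //; rewrite big1 // => i _; rewrite scale0r.
- exists (fun i => c i + d i); split=> [i|]; first exact: addr_ge0.
  by rewrite -big_split; apply: eq_bigr => i _; rewrite scalerDl.
- exists (fun i => k * c i); split=> [i|]; first exact: mulr_ge0.
  by rewrite scaler_sumr; apply: eq_bigr => i _; rewrite scalerA.
Qed.

Lemma cone_mem (S : seq V) v : v \in S -> cone S v.
Proof.
move=> vS; have vi : (index v S < size S)%N by rewrite index_mem.
exists (fun i => (i == Ordinal vi)%:R); split=> [i|]; first exact: ler0n.
rewrite (bigD1 (Ordinal vi)) //= eqxx scale1r nth_index // big1 ?addr0 //.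
by move=> i /negPf->; rewrite scale0r.
Qed.

Lemma cone_subset (S : seq V) C : is_cone C ->
  (forall v, v \in S -> C v) -> cone S `<=` C.
Proof.
case=> C0 CD CZ SC v [c [c0 ->]].
elim/big_ind: _ => // i _; apply: CZ => //; apply: SC; exact: mem_nth.
Qed.

Lemma setadd_cone C D : is_cone C -> is_cone D -> is_cone (setadd C D).
Proof.
move=> [C0 CD CZ] [D0 DD DZ].
split=> [|p q [c Cc [d Dd <-]] [c' Cc' [d' Dd' <-]]|k p k0 [c Cc [d Dd <-]]].
- by exists 0 => //; exists 0; rewrite ?addr0.
- by rewrite addrACA; exists (c + c'); [exact: CD|exists (d + d'); first exact: DD].
- by rewrite scalerDr; exists (k *: c); [exact: CZ|exists (k *: d); first exact: DZ].
Qed.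

Lemma setadd_subset C D (E : set V) : is_cone E ->
  C `<=` E -> D `<=` E -> setadd C D `<=` E.
Proof.
by move=> [_ ED _] CE DE _ [c Cc [d Dd <-]]; apply: ED; [exact: CE|exact: DE].
Qed.

Lemma subset_setaddl C D : D 0 -> C `<=` setadd C D.
Proof. by move=> D0 c Cc; exists c => //; exists 0; rewrite ?addr0. Qed.

Lemma subset_setaddr C D : C 0 -> D `<=` setadd C D.
Proof. by move=> C0 d Dd; exists 0 => //; exists d; rewrite ?add0r. Qed.

(** The right-hand side is a group containing the units, so it suffices to check the generators. *)
Lemma setadd_units_zspan_subset C (S T : seq V) : is_cone C ->
  (forall v, v \in S -> setadd (units C) (zspan T) v) ->
  setadd (units C) (zspan S) `<=` setadd (units C) (zspan T).
Proof.
move=> coneC ST.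
have subG u v : setadd (units C) (zspan T) u -> setadd (units C) (zspan T) v ->
    setadd (units C) (zspan T) (u - v).
  move=> [a Ua [s Ts <-]] [b Ub [t Tt <-]]; rewrite opprD addrACA.
  exists (a - b); first exact: unitsB.
  by exists (s - t) => //; apply: zspanB.
have G0 : setadd (units C) (zspan T) 0.
  by apply: subset_setaddl (units0 coneC); apply: zspan0.
move=> _ [u Uu [s Ss <-]]; apply: (subgroupD G0 subG).
  by apply: subset_setaddl Uu; apply: zspan0.
exact: zspan_sub Ss.
Qed.

End Cones.

(** * Ideals, algebraic cones and cutting-plane closures *)

Section PolynomialCones.
Variable n : nat.
Implicit Types (p q : {mpoly rat[n]}) (Z P B S : seq {mpoly rat[n]})
  (C D L : set {mpoly rat[n]}).

Lemma ideal_is_ideal Z : is_ideal (ideal Z).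
Proof.
split=> [|p q [c ->] [d ->]|p q [c ->]].
- by exists (fun=> 0); rewrite big1 // => i _; rewrite mul0r.
- exists (fun i => c i + d i); rewrite -big_split.
  by apply: eq_bigr => i _; rewrite mulrDl.
- exists (fun i => p * c i); rewrite mulr_sumr.
  by apply: eq_bigr => i _; rewrite mulrA.
Qed.

Lemma ideal_mem Z p : p \in Z -> ideal Z p.
Proof.
move=> pZ; have pi : (index p Z < size Z)%N by rewrite index_mem.
exists (fun i => (i == Ordinal pi)%:R).
rewrite (bigD1 (Ordinal pi)) //= eqxx mul1r nth_index // big1 ?addr0 //.
by move=> i /negPf->; rewrite mul0r.
Qed.

Lemma ideal_subset Z (I : set {mpoly rat[n]}) : is_ideal I ->
  (forall p, p \in Z -> I p) -> ideal Z `<=` I.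
Proof.
case=> I0 ID IM ZI p [c ->].
elim/big_ind: _ => // i _; apply: IM; apply: ZI; exact: mem_nth.
Qed.

Lemma ideal_is_cone (I : set {mpoly rat[n]}) : is_ideal I -> is_cone I.
Proof. by move=> idI; case: (idI) => ? ? _; split=> // k p _; apply: ideal_scale. Qed.

Lemma alg_cone_is_cone Z P : is_cone (alg_cone Z P).
Proof.
by apply: setadd_cone (cone_is_cone P); apply/ideal_is_cone/ideal_is_ideal.
Qed.

Lemma ideal_sub_alg_cone Z P : ideal Z `<=` alg_cone Z P.
Proof. by apply: subset_setaddl; case: (cone_is_cone P). Qed.

Lemma cone_sub_alg_cone Z P : cone P `<=` alg_cone Z P.
Proof. by apply: subset_setaddr; case: (ideal_is_ideal Z). Qed.

Lemma ideal_sub_units Z P : ideal Z `<=` units (alg_cone Z P).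
Proof.
move=> p Zp; split; apply: ideal_sub_alg_cone => //.
by rewrite -scaleN1r; apply: ideal_scale (ideal_is_ideal Z) Zp.
Qed.

(** Regularity makes the units an ideal, so they contain all of [ideal Z] once they contain [Z]. *)
Lemma alg_cone_subset Z P C : regular C ->
  (forall z, z \in Z -> units C z) -> (forall p, p \in P -> C p) ->
  alg_cone Z P `<=` C.
Proof.
move=> [coneC _ idC] ZC PC; apply: setadd_subset => //.
  by move=> p /(ideal_subset idC ZC)[].
exact: cone_subset.
Qed.

Lemma cp_closed_subset L L' C : L `<=` L' -> cp_closed L' C -> cp_closed L C.
Proof. by move=> LL' clC a b p a0 /LL'; apply: clC. Qed.

(** For [p = u + v] with a unit [u], subtract [a] times [u] from the premise, cut with [v], and add
    [u] back. *)
Lemma cp_closed_units L C : is_cone C ->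
  cp_closed L C -> cp_closed (setadd (units C) L) C.
Proof.
move=> coneC clC a b _ a0 [u Uu [v Lv <-]] Cuv.
have [_ CD _] := coneC.
rewrite -addrA; apply: (CD); first by case: Uu.
apply: clC => //; rewrite -(addKr (u *~ a) (_ + _)).
apply: CD; last by rewrite addrA -mulrzDl.
by case: (unitsMz a coneC Uu).
Qed.

Lemma cp_incl (W L S : set {mpoly rat[n]}) : S `<=` cp W L S.
Proof. by move=> p Sp C _ _ SC _; apply: SC. Qed.

Lemma cp_is_cone (W L S : set {mpoly rat[n]}) : is_cone (cp W L S).
Proof.
split=> [C _ [] //|p q cp_p cp_q C CW coneC SC clC|k p k0 cp_p C CW coneC SC clC].
  by case: (coneC) => _ CD _; exact: (CD _ _ (cp_p C CW coneC SC clC) (cp_q C CW coneC SC clC)).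
by case: (coneC) => _ _ CZ; exact: (CZ _ _ k0 (cp_p C CW coneC SC clC)).
Qed.

Lemma cp_cp_closed (W L S : set {mpoly rat[n]}) : cp_closed L (cp W L S).
Proof.
move=> a b p a0 Lp cp_p C CW coneC SC clC.
exact: (clC _ _ _ a0 Lp (cp_p C CW coneC SC clC)).
Qed.

(** Each reduction step subtracts a multiple of an element of [Z]. *)
Lemma red_congr (le : rel 'X_{1..n}) Z p : ideal Z (p - red le Z p).
Proof.
(* Where no normal form is found, [xget] returns [p] and the difference is zero. *)
rewrite /red; case: xgetP => [r _ [pr _]|_]; last first.
  by rewrite subrr; case: (ideal_is_ideal Z).
have [I0 ID IM] := ideal_is_ideal Z.
elim: pr => {p r} [p q [z [m' [m [zZ _ _ _ ->]]]]|p|p q r _ pq _ qr].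
- rewrite opprB addrC subrK; apply: ideal_scale (ideal_is_ideal Z) _.
  exact/IM/ideal_mem.
- by rewrite subrr.
- by rewrite -(subrKA q); apply: ID.
Qed.

End PolynomialCones.

(** * The affine substitution and the cut *)

Section AffineSubstitution.
Variables (n : nat) (B : seq {mpoly rat[n]}).
Local Notation W := (@affine_polys (size B)).
Local Notation Y := [seq 'X_i | i <- enum 'I_(size B)].
Local Notation g := (@affine_subst n B).

(** Taking coefficients is linear on all polynomials, so [g] is a linear map on the whole ring and
    not only on [W]. *)
Lemma affine_subst_is_linear : linear g.
Proof.
move=> a f h; rewrite /affine_subst mcoeffD mcoeffZ scalerDr mpolyCD addrACA.
congr (_ + _); first by rewrite mpolyCM mul_mpolyC.
rewrite scaler_sumr -big_split; apply: eq_bigr => i _ /=.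
by rewrite mcoeffD mcoeffZ scalerDl scalerA.
Qed.

HB.instance Definition _ := GRing.isLinear.Build rat {mpoly rat[size B]}
  {mpoly rat[n]} *:%R g affine_subst_is_linear.

Lemma affine_subst_int (b : int) : g b%:~R = b%:~R.
Proof.
rewrite raddfMz; congr (_ *~ b); rewrite /= /affine_subst mcoeff1 eqxx.
rewrite big1 ?addr0 ?mpolyC1 // => i _.
by rewrite mcoeff1 mnm1_eq0 scale0r.
Qed.

Lemma affine_subst_var i : g 'X_i = B`_i.
Proof.
rewrite /affine_subst mcoeffX mnm1_eq0 add0r (bigD1 i) //= mcoeffXU eqxx.
rewrite scale1r big1 ?addr0 // => j ji.
by rewrite mcoeffXU eq_sym (negPf ji) scale0r.
Qed.

Lemma affine_linear a f h : W f -> W h -> W (a *: f + h).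
Proof.
move=> Wf Wh; apply: leq_trans (msizeD_le _ _) _; rewrite geq_max [X in _ && X]Wh.
by rewrite (leq_trans (msizeZ_le _ _)).
Qed.

Lemma affine_is_cone : is_cone W.
Proof.
have W0 : W 0 by rewrite /affine_polys /= msize0.
split=> // [p q Wp Wq|k p _ Wp].
  by rewrite -(scale1r p); apply: affine_linear.
by rewrite -[_ *: _]addr0; apply: affine_linear.
Qed.

Lemma affineB f h : W f -> W h -> W (f - h).
Proof. by move=> Wf Wh; rewrite addrC -scaleN1r; apply: affine_linear. Qed.

Lemma affine_int (b : int) : W b%:~R.
Proof.
have [W0 _ _] := affine_is_cone.
apply: (@subgroupMz _ W) => //; first by move=> ? ?; exact: affineB.
by rewrite /affine_polys /= msize1.
Qed.

Lemma zspan_vars_affine : zspan Y `<=` W.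
Proof.
have [W0 _ _] := affine_is_cone.
apply: zspan_sub => // [? ?|_ /mapP[i _ ->]]; first exact: affineB.
by rewrite /affine_polys /= msizeX mdeg1.
Qed.

Lemma affine_cut (a b : int) y : zspan Y y -> W (y *~ a + b%:~R).
Proof.
move=> Yy; have [_ WD _] := affine_is_cone; apply: WD; last exact: affine_int.
by apply: zspan_vars_affine; apply: zspanMz.
Qed.

Lemma affine_subst_cut (a b : int) y : g (y *~ a + b%:~R) = g y *~ a + b%:~R.
Proof. by rewrite raddfD raddfMz /= affine_subst_int. Qed.

Lemma affine_subst_zspan y : zspan Y y -> zspan B (g y).
Proof.
move: y; apply: (@zspan_sub _ Y (g @^-1` zspan B)) => /=.
- by rewrite raddf0; apply: zspan0.
- by move=> u v; rewrite raddfB; apply: zspanB.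
- move=> _ /mapP[i _ ->]; rewrite affine_subst_var; apply: zspan_mem.
  exact: mem_nth.
Qed.

Lemma zspan_affine_subst v : zspan B v -> exists2 y, zspan Y y & g y = v.
Proof.
case=> c ->; exists (\sum_(i < size B) 'X_i *~ c i).
  apply: (big_ind (zspan Y)); [exact: zspan0|exact: zspanD|move=> i _].
  by apply/zspanMz/zspan_mem/map_f; rewrite mem_enum.
by rewrite raddf_sum; apply: eq_bigr => i _; rewrite raddfMz /= affine_subst_var.
Qed.

Variables Z P : seq {mpoly rat[n]}.
Local Notation C := (alg_cone Z P).

Lemma preimage_is_cone (D : set {mpoly rat[n]}) :
  is_cone D -> is_cone (W `&` g @^-1` D).
Proof.
move=> [D0 DD DZ]; have [W0 WD WZ] := affine_is_cone.
split=> /= [|p q [Wp Dp] [Wq Dq]|k p k0 [Wp Dp]].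
- by rewrite raddf0.
- by rewrite raddfD; split; [apply: WD|apply: DD].
- by rewrite linearZ; split; [apply: WZ|apply: DZ].
Qed.

Lemma preimage_cp_closed (D : set {mpoly rat[n]}) :
  cp_closed (zspan B) D -> cp_closed (zspan Y) (W `&` g @^-1` D).
Proof.
(* Writing [y] as [y *~ 1] gives the conclusion the shape to which the lemmas on cuts apply. *)
move=> clD a b y a0 Yy [_ /= Dy]; rewrite -[y]mulr1z; split=> /=.
  exact: affine_cut.
rewrite affine_subst_cut mulr1z; apply: clD => //.
  exact: affine_subst_zspan.
by rewrite -affine_subst_cut.
Qed.

(** The affine preimage of [D] takes part in the intersection that defines [cp], so it contains the
    closure. *)
Lemma cut_set_subset (D : set {mpoly rat[n]}) : is_cone D ->
  C `<=` D -> cp_closed (zspan B) D -> cut_set Z P B `<=` D.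
Proof.
move=> coneD CD clD _ [f cpf <-].
have [] : (W `&` g @^-1` D) f; last by [].
apply: cpf; first by move=> ? [].
- exact: preimage_is_cone.
- by move=> h [Wh /CD].
- exact: preimage_cp_closed.
Qed.

(** [W] itself takes part in the intersection that defines [cp]. *)
Lemma cp_affine : cp W (zspan Y) (W `&` g @^-1` C) `<=` W.
Proof.
move=> f; apply; [by []|exact: affine_is_cone|by move=> ? []|].
by move=> a b y _ Yy _; rewrite -[y]mulr1z; apply: affine_cut.
Qed.

Lemma cut_set_is_cone : is_cone (cut_set Z P B).
Proof.
have [K0 KD KZ] := cp_is_cone W (zspan Y) (W `&` g @^-1` C).
split=> [|_ _ [f Kf <-] [h Kh <-]|k _ k0 [f Kf <-]].
- by exists 0 => //; rewrite raddf0.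
- by exists (f + h); [exact: KD|rewrite raddfD].
- by exists (k *: f); [exact: KZ|rewrite linearZ].
Qed.

Lemma cut_set_incl f : W f -> C (g f) -> cut_set Z P B (g f).
Proof. by move=> Wf Cf; exists f => //; apply: cp_incl. Qed.

(* [g] need not be injective, but its kernel lies in the preimage of the cone,
   so every affine preimage of an element of [cut_set] lies in the closure. *)
Lemma cut_set_cp_closed : cp_closed (zspan B) (cut_set Z P B).
Proof.
move=> a b v a0 /zspan_affine_subst[y Yy <-] [f cpf gf].
set K := cp _ _ _ in cpf.
have Kcut : K (y *~ a + b%:~R).
  rewrite -(subrK f (_ + _)); have [_ KD _] := cp_is_cone W (zspan Y) (W `&` g @^-1` C).
  apply: KD => //; apply: cp_incl; split=> /=.
    by apply: affineB; [exact: affine_cut|exact: cp_affine].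
  by rewrite raddfB /= affine_subst_cut gf subrr; case: (alg_cone_is_cone Z P).
exists (y + (Num.floor (b%:Q / a%:Q))%:~R); first exact: cp_cp_closed Kcut.
by rewrite -[in LHS](mulr1z y) affine_subst_cut mulr1z.
Qed.

(* Since [cut_set] is contained in the range of [g], an element of
   [C + cut_set] in that range already lies in [cut_set]. If the units do not
   grow, [C + cut_set] is regular, hence it is the next cone. *)
Lemma next_cone_cp_closed (C' : set {mpoly rat[n]}) : regular C ->
  is_least (fun D => [/\ regular D, C `<=` D & cut_set Z P B `<=` D]) C' ->
  units C' = units C -> cp_closed (zspan B) C'.
Proof.
move=> [coneC C1 idC] [[[coneC' C'1 idC'] CC' KC'] leastC'] unitsE.
have coneK := cut_set_is_cone.
have sumC' : C' `<=` setadd C (cut_set Z P B).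
  have CE : C `<=` setadd C (cut_set Z P B).
    by apply: subset_setaddl; case: coneK.
  have KE : cut_set Z P B `<=` setadd C (cut_set Z P B).
    by apply: subset_setaddr; case: coneC.
  apply: leastC'; split=> //; split.
  - exact: setadd_cone.
  - exact: CE.
  (* The units of the sum lie between those of [C] and those of [C'], which agree. *)
  - rewrite (_ : units _ = units C) //; apply/seteqP; split.
      by rewrite -unitsE; apply: units_subset; apply: setadd_subset.
    exact: units_subset.
move=> a b v a0 Bv /sumC'[c Cc [d Kd cdE]].
apply: KC'; apply: cut_set_cp_closed => //; rewrite -cdE.
have [_ KD _] := coneK; apply: KD => //.
have [y Yy gy] := zspan_affine_subst Bv.
have [f cpf gf] := Kd.
have cE : c = g (y *~ a + b%:~R - f).
  by rewrite raddfB /= affine_subst_cut gy gf -cdE addrK.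
rewrite cE; apply: cut_set_incl; last by rewrite -cE.
by apply: affineB; [exact: affine_cut|exact: cp_affine].
Qed.

End AffineSubstitution.

(** * The procedure *)

Section Procedure.
Variables (n : nat) (le : rel 'X_{1..n}).
Variable saturate :
  seq {mpoly rat[n]} -> seq {mpoly rat[n]} * seq {mpoly rat[n]}.
Variable cut :
  seq {mpoly rat[n]} -> seq {mpoly rat[n]} -> seq {mpoly rat[n]} ->
  seq {mpoly rat[n]}.
Hypothesis saturateP : saturate_spec le saturate.
Hypothesis cutP : cut_spec le cut.
Implicit Types (s t : rcp_state n) (C D : set {mpoly rat[n]}).
Local Notation body := (rcp_body le saturate cut).

(** What [cut_spec] requires. Regularity is not included: the input cone may lack it, and the first
    iteration establishes it. *)
Definition valid_state s := reduced le (st_Z s) (st_P s) /\ lin_indep (st_B s).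
Local Notation st_cut s := (cut_set (st_Z s) (st_P s) (st_B s)).

Lemma rcp_body_exists s : exists t, body s t.
Proof.
case: s => Z0 P0 B0; rewrite /rcp_body.
case def_ZP: (saturate _) => [Z' P'].
have [B' B'P] := lattice_basis_exists [seq red le Z' b | b <- B0].
by exists (RcpState Z' P' B').
Qed.

Lemma rcp_body_valid s t : body s t -> valid_state t.
Proof.
case: s t => [Z0 P0 B0] [Z' P' B'] /= [ZP [indB' _]]; split=> //=.
by have [] := saturateP (Z0 ++ [seq - z | z <- Z0] ++ P0 ++ cut Z0 P0 B0);
  rewrite -ZP.
Qed.

(** Passing both [Z0] and its negatives to [saturate] makes the elements of [Z0] units, so a regular
    cone contains the generators passed exactly when it contains [st_cone s] and the cut. *)
Lemma rcp_body_least s t : valid_state s -> body s t ->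
  is_least (fun D => [/\ regular D, st_cone s `<=` D & st_cut s `<=` D])
    (st_cone t).
Proof.
case: s t => [Z0 P0 B0] [Z' P' B'] [/= redZP indB] [ZP _].
have := (saturateP (Z0 ++ [seq - z | z <- Z0] ++ P0 ++ cut Z0 P0 B0)).2.
rewrite -ZP /st_cone /= -(cutP redZP indB) => -[[regC QC] leastC]; split.
  have memC p : p \in Z0 ++ [seq - z | z <- Z0] ++ P0 ++ cut Z0 P0 B0 ->
    alg_cone Z' P' p by exact: QC.
  split=> //; last first.
    case: regC => coneC _ _; apply: cone_subset => // p pC.
    by apply: memC; rewrite !mem_cat pC !orbT.
  apply: alg_cone_subset => // [z zZ|p pP]; last first.
    by apply: memC; rewrite !mem_cat pP !orbT.
  split; apply: memC; rewrite !mem_cat ?zZ //.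
  by rewrite map_f ?orbT.
move=> D [regD CD cutD]; apply: leastC; split=> // q /=.
rewrite !mem_cat => /or4P[qZ|/mapP[z zZ ->]|qP|qcut].
- exact/CD/ideal_sub_alg_cone/ideal_mem.
- by apply: CD; case: (ideal_sub_units P0 (ideal_mem zZ)).
- exact/CD/cone_sub_alg_cone/cone_mem.
- exact/cutD/cone_mem.
Qed.

(** [D] is kept general: it is the new cone in the termination proof and a competing cone in the
    minimality proof. *)
Lemma rcp_body_lattice s t D : body s t -> is_cone D -> st_cone t `<=` D ->
  setadd (units D) (zspan (st_B t)) = setadd (units D) (zspan (st_B s)).
Proof.
case: s t => [Z0 P0 B0] [Z' P' B'] [_ /= [_ ->]] coneD CD.
have red_units (c : {mpoly rat[n]}) : units D (c - red le Z' c).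
  exact: units_subset CD _ (ideal_sub_units P' (red_congr le Z' c)).
apply/seteqP; split; apply: setadd_units_zspan_subset => // b.
  move=> /mapP[c cB ->]; exists (- (c - red le Z' c)).
    exact: unitsN (red_units c).
  by exists c; [exact: zspan_mem|rewrite opprB subrK].
move=> bB; exists (b - red le Z' b); first exact: red_units.
exists (red le Z' b); last by rewrite subrK.
by apply: zspan_mem; apply: map_f.
Qed.

(** The current cone contains its own cut, so it is itself a candidate for the next cone. *)
Lemma rcp_body_fixpoint s t : valid_state s -> regular (st_cone s) ->
  cp_closed (zspan (st_B s)) (st_cone s) -> body s t -> st_cone t = st_cone s.
Proof.
move=> vs regC clC st; have [[_ CC' _] leastC'] := rcp_body_least vs st.
apply/seteqP; split=> //; apply: leastC'; split=> //.
by case: (regC) => coneC _ _; apply: cut_set_subset.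
Qed.

Lemma rcp_terminates_regular s : valid_state s -> regular (st_cone s) ->
  rcp_terminates le saturate cut s.
Proof.
move: {2}(units (st_cone s)) (erefl (units (st_cone s))) => I.
elim/(well_founded_ind (@ideal_supset_wf n)): I s => I IH s unitsI vs regC.
apply: RcpTerminates => [|t st _]; first exact: rcp_body_exists.
have vt := rcp_body_valid st.
have leastC' := rcp_body_least vs st.
have [[regC' CC' _] _] := leastC'.
have [unitsE|unitsN] := pselect (units (st_cone t) = units (st_cone s)).
  apply: RcpTerminates => [|t' tt' ct']; first exact: rcp_body_exists.
  case: ct'; apply: rcp_body_fixpoint => //.
  have [coneC' _ _] := regC'.
  (* [next_cone_cp_closed] concerns the old basis; adding the units of the new cone carries the
     closure over to the new basis. *)
  apply: cp_closed_subset
    (cp_closed_units coneC' (next_cone_cp_closed regC leastC' unitsE)).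
  rewrite -(rcp_body_lattice st coneC') //.
  by apply: subset_setaddr; apply: units0.
apply: (IH (units (st_cone t))) => //; rewrite -unitsI; split=> //.
- by case: regC'.
- by case: regC.
- exact: units_subset.
Qed.

(** One iteration makes the cone regular, after which the induction on units applies. *)
Lemma rcp_terminates_valid s : valid_state s -> rcp_terminates le saturate cut s.
Proof.
move=> vs; apply: RcpTerminates => [|t st _]; first exact: rcp_body_exists.
have [[regC' _ _] _] := rcp_body_least vs st.
exact: rcp_terminates_regular (rcp_body_valid st) regC'.
Qed.

(** The cones that the theorem minimizes over, relative to the current state instead of the input,
    so that iterations can be compared. *)
Definition rcp_closed s D :=
  [/\ regular D, st_cone s `<=` D
    & cp_closed (setadd (units D) (zspan (st_B s))) D].

(** A cone satisfying [rcp_closed s] contains the cut of [s], hence the next cone; the two lattices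
    agree modulo its units. *)
Lemma rcp_body_closed s t D : valid_state s -> body s t ->
  rcp_closed s D <-> rcp_closed t D.
Proof.
move=> vs st; have [[_ CC' _] leastC'] := rcp_body_least vs st.
split=> -[regD CD clD]; have [coneD _ _] := regD; last first.
  split=> //; first exact: subset_trans CD.
  by rewrite -(rcp_body_lattice st).
have C'D : st_cone t `<=` D.
  apply: leastC'; split=> //; apply: cut_set_subset => //.
  by apply: cp_closed_subset clD; apply: subset_setaddr; apply: units0.
by split=> //; rewrite (rcp_body_lattice st).
Qed.

(** At the exit the cone contains its own cut, which makes it closed under cutting planes;
    [rcp_body_closed] carries the result back through the earlier iterations. *)
Lemma rcp_returns_least s Z P : valid_state s ->
  rcp_returns le saturate cut s Z P -> is_least (rcp_closed s) (alg_cone Z P).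
Proof.
move=> vs ret; elim: ret vs => {s Z P} [s Z P t st CE <- <-|s Z P t st _ _ IH] vs.
  rewrite -/(st_cone t) CE; split=> [|D []//].
  have [[regC' _ cutC'] _] := rcp_body_least vs st.
  rewrite CE in regC' cutC'; split=> //; have [coneC _ _] := regC'.
  apply: cp_closed_units => // a b v a0 Bv Cv.
  apply: cutC'; apply: cut_set_cp_closed => //.
  (* The premise of the cut is the image of an affine polynomial, and every such element of the cone
     lies in [cut_set]. *)
  have [y Yy gy] := zspan_affine_subst Bv.
  rewrite -gy -affine_subst_cut; apply: cut_set_incl; first exact: affine_cut.
  by rewrite affine_subst_cut gy.
have [closedC leastC] := IH (rcp_body_valid st).
split=> [|D closedD]; first exact/(rcp_body_closed _ vs st).
by apply: leastC; apply/(rcp_body_closed _ vs st).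
Qed.

End Procedure.

Theorem theorem4p11 (n : nat) (le : rel 'X_{1..n})
    (saturate : seq {mpoly rat[n]} -> seq {mpoly rat[n]} * seq {mpoly rat[n]})
    (cut : seq {mpoly rat[n]} -> seq {mpoly rat[n]} -> seq {mpoly rat[n]} ->
           seq {mpoly rat[n]})
    (Z P B : seq {mpoly rat[n]})
    (le_order : monomial_order le)
    (saturateP : saturate_spec le saturate)
    (cutP : cut_spec le cut)
    (redZP : reduced le Z P) :
  (exists B0 : seq {mpoly rat[n]}, lattice_basis B B0) /\
  (forall B0 : seq {mpoly rat[n]}, lattice_basis B B0 ->
     rcp_terminates le saturate cut (RcpState Z P B0) /\
     (forall Z' P' : seq {mpoly rat[n]},
        rcp_returns le saturate cut (RcpState Z P B0) Z' P' ->
        is_least (fun C : set {mpoly rat[n]} =>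
                    [/\ regular C,
                        alg_cone Z P `<=` C
                      & cp_closed (setadd (units C) (zspan B)) C])
                 (alg_cone Z' P'))).
Proof.
split=> [|B0 [indB0 B0E]]; first exact: lattice_basis_exists.
have valid0 : valid_state le (RcpState Z P B0) by [].
split=> [|Z' P' ret]; first exact: rcp_terminates_valid.
by rewrite -B0E; apply: rcp_returns_least ret.
Qed.
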